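(* Let $A\in\mathbb{C}^{n\times n}$ with $\mathrm{ind}(A)=k>0$, and let $B\in\mathbb{C}^{n\times n}$ with $\mathrm{ind}(B)=s$. Put $L_B=B^2B^{\odot}$. Then the following conditions are equivalent: (i) $B$ is a stable perturbation of $A$; (ii) $L_B$ is a stable perturbation of $A$; (iii) $\mathrm{rk}(B^s)=\mathrm{rk}(A^k)=\mathrm{rk}\big((A^k)^*L_BA^k\big)$; (iv) $R(A^k)\cap N((B^s)^* )=\{0\}$ and $R(B^s)\cap N((A^k)^* )=\{0\}$; (v) $I+(L_B-A)A^{\odot}$ is nonsingular and $A^{\pi}\big(I+(L_B-A)A^{\odot}\big)^{-1}L_B=0$; (vi) if $A$ is written in its core-EP decomposition $A=U\begin{pmatrix} T & S \\ 0 & N \end{pmatrix}U^*$ (with $U$ unitary, $T\in\mathbb{C}^{r\times r}$ nonsingular, $N$ nilpotent, $r=\mathrm{rk}(A^k)$), then $L_B$ has the form $$L_B=U\begin{pmatrix} B_1 & B_1 P \\ Q B_1 & Q B_1 P \end{pmatrix}U^*$$ for some matrices $B_1\in\mathbb{C}^{r\times r}$, $P\in\mathbb{C}^{r\times(n-r)}$, $Q\in\mathbb{C}^{(n-r)\times r}$ such that $B_1$ and $I+PQ$ are nonsingular; (vii) $\mathrm{rk}(B^s)=\mathrm{rk}(A^k)$ and $I+(L_B-A)A^{\odot}$ is nonsingular.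
   Context: $R(\cdot)$, $N(\cdot)$, $\mathrm{rk}(\cdot)$ and $(\cdot)^*$ denote range, null space, rank and conjugate transpose. The index $\mathrm{ind}(M)$ of a square matrix $M$ is the smallest nonnegative integer $m$ with $\mathrm{rk}(M^{m+1})=\mathrm{rk}(M^m)$ (with $M^0=I$), so $\mathrm{ind}(M)>0$ exactly when $M$ is singular. For $M\in\mathbb{C}^{n\times n}$ with $\mathrm{ind}(M)=m$, $M^{\odot}$ denotes the core-EP inverse of $M$: the unique $X\in\mathbb{C}^{n\times n}$ with $XM^{m+1}=M^m$, $MX^2=X$, $(MX)^*=MX$. Put $M^{\pi}:=I-MM^{\odot}$, which is an orthogonal projector. A matrix $C\in\mathbb{C}^{n\times n}$ is a stable perturbation of $A$ (with respect to the core-EP inverse) if $I-(C^{\pi}-A^{\pi})^2$ is nonsingular. Core-EP decomposition: every $A\in\mathbb{C}^{n\times n}$ with $\mathrm{ind}(A)=k$ can be written as $A=U\begin{pmatrix} T & S \\ 0 & N \end{pmatrix}U^*$ with $U$ unitary, $T\in\mathbb{C}^{r\times r}$ nonsingular, $N$ nilpotent with $N^k=0$, and $r=\mathrm{rk}(A^k)$. *)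

(* Defs.v *)
From HB Require Import structures.
From mathcomp Require Import all_boot all_order all_algebra.
From mathcomp Require Import boolp classical_sets reals.
From mathcomp Require Import complex.
Set Implicit Arguments.
Unset Strict Implicit.
Unset Printing Implicit Defensive.
Import Order.TTheory GRing.Theory Num.Theory.
Local Open Scope ring_scope.
Local Open Scope sesquilinear_scope.
Local Open Scope classical_set_scope.

(* Matrices act on column vectors; [mxalgebra]'s row-space operations concern
   the action on row vectors, so range and null space are defined here. *)
Definition mxrange (C : numClosedFieldType) (m n : nat) (M : 'M[C]_(m, n)) :
    set 'cV[C]_m :=
  range (fun x : 'cV[C]_n => M *m x).

Definition mxnull (C : numClosedFieldType) (m n : nat) (M : 'M[C]_(m, n)) :
    set 'cV[C]_n :=
  [set x | M *m x = 0].

Lemma mxind_subproof (C : numClosedFieldType) (n : nat) (M : 'M[C]_n) :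
  exists m, \rank (M ^+ m.+1) == \rank (M ^+ m).
Proof.
suff [//|H] : (exists m, \rank (M ^+ m.+1) == \rank (M ^+ m)) \/
              (forall m, \rank (M ^+ m) + m <= n)%N.
  by have := H n.+1; rewrite addnS ltnNge leq_addl.
case: (pselect (exists m, \rank (M ^+ m.+1) == \rank (M ^+ m))) => [|nex].
  by left.
right; elim=> [|m IHm]; first by rewrite addn0 rank_leq_row.
apply: leq_trans IHm; rewrite addnS ltn_add2r ltn_neqAle; apply/andP; split.
  by apply/negP => e; apply: nex; exists m.
by rewrite exprSr; apply: mxrankM_maxl.
Qed.

Definition mxind (C : numClosedFieldType) (n : nat) (M : 'M[C]_n) : nat :=
  ex_minn (mxind_subproof M).

Definition is_core_EP (C : numClosedFieldType) (n : nat) (M X : 'M[C]_n) :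
    Prop :=
  let m := mxind M in
  [/\ X *m M ^+ m.+1 = M ^+ m,
      M *m X ^+ 2 = X &
      (M *m X)^t* = M *m X].

(* Every square matrix has exactly one core-EP inverse, so the default value
   [0] of [xget] is never returned. *)
Definition core_EP (C : numClosedFieldType) (n : nat) (M : 'M[C]_n) : 'M[C]_n :=
  xget 0 [set X | is_core_EP M X].

Definition core_EP_proj (C : numClosedFieldType) (n : nat) (M : 'M[C]_n) :
    'M[C]_n :=
  1%:M - M *m core_EP M.

(* [B] is a stable perturbation of [A]. *)
Definition stable_perturbation (C : numClosedFieldType) (n : nat)
    (A B : 'M[C]_n) : Prop :=
  1%:M - (core_EP_proj B - core_EP_proj A) ^+ 2 \in unitmx.

(* The n x n matrix with blocks of sizes r and n - r; the cast is along
   r + (n - r) = n. *)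
Definition sqblock (C : numClosedFieldType) (n r : nat) (hr : (r <= n)%N)
    (Aul : 'M[C]_r) (Aur : 'M[C]_(r, n - r))
    (Adl : 'M[C]_(n - r, r)) (Adr : 'M[C]_(n - r)) : 'M[C]_n :=
  castmx (subnKC hr, subnKC hr) (block_mx Aul Aur Adl Adr).

Definition core_EP_decomposition (C : numClosedFieldType) (n : nat)
    (A : 'M[C]_n) (r : nat) (hr : (r <= n)%N) (U : 'M[C]_n)
    (T : 'M[C]_r) (S : 'M[C]_(r, n - r)) (N : 'M[C]_(n - r)) : Prop :=
  [/\ U \is unitarymx,
      T \in unitmx,
      N ^+ mxind A = 0,
      r = \rank (A ^+ mxind A) &
      A = U *m sqblock hr T S 0 N *m U^t*].

(* Main.v *)
Require Import Defs.
From mathcomp Require Import all_boot all_order all_algebra.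
From mathcomp Require Import boolp classical_sets reals.
From mathcomp Require Import complex.
Set Implicit Arguments.
Unset Strict Implicit.
Unset Printing Implicit Defensive.
Import Order.TTheory GRing.Theory Num.Theory.
Local Open Scope ring_scope.
Local Open Scope sesquilinear_scope.
Local Open Scope classical_set_scope.

(** The whole statement is about the position of the two subspaces R(A^k) and
    R(B^s) relative to each other.  Take an orthonormal basis E of R(A^k) and an
    orthonormal basis F of R(B^s).  Both subspaces are invariant and the
    matrices act on them bijectively, say A E = E T and B F = F M with T and M
    nonsingular, so that the core-EP inverses are E T^-1 E^* and F M^-1 F^*
    ([core_EP_frame]).  The complementary projectors are then 1 - E E^* and
    1 - F F^*, and L_B = F M F^* is the part of B that lives on R(B^s).

    Each of the conditions says that the overlap matrix K = E^* F is square and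
    nonsingular, that is, that no nonzero vector of one subspace is orthogonal
    to the other.

    - (i), (ii): D = 1 - (E E^* - F F^* )^2 satisfies D E = E K K^* and
      D F = F K^* K, and is the identity on vectors orthogonal to both
      subspaces, so D is nonsingular exactly when K is
      ([stable_perturbation_frame]).  L_B has the same projector as B.
    - (iv): the two trivial intersections are the injectivity of K^* and of K
      ([cap_trivial_frame]).
    - (iii), (vii): both reduce to the nonsingularity of the compression
      E^* L_B E = K M K^*, together with the equality of ranks
      ([gram_rank_frame], [unitmx_1D_frame], [overlapP]).
    - (v): the equation expresses that the Schur complement of that compression
      in L_B vanishes, which, given the first half of (v), forces
      rk L_B = rk A^k ([schur_complement_frame]).
    - (vi): the block form is the factorization of L_B through K in an
      orthonormal basis extending E ([block_frame]).  For this, any core-EP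
      decomposition of A provides such a basis, and decompositions exist
      ([core_EP_decomposition_frame], [core_EP_decomposition_exists]). *)

(** * Adjoints of matrices *)

Lemma adjmxM (C : numClosedFieldType) (m n p : nat) (X : 'M[C]_(m, n))
    (Y : 'M[C]_(n, p)) : (X *m Y)^t* = Y^t* *m X^t*.
Proof. by rewrite trmx_mul map_mxM. Qed.

Lemma adjmxK (C : numClosedFieldType) (m n : nat) (X : 'M[C]_(m, n)) :
  (X^t*)^t* = X.
Proof. by apply/matrixP => i j; rewrite !mxE conjCK. Qed.

Lemma adjmx1 (C : numClosedFieldType) (n : nat) :
  (1%:M : 'M[C]_n)^t* = 1%:M.
Proof. by rewrite trmx1 map_mx1. Qed.

Lemma mxrank_adj (C : numClosedFieldType) (m n : nat) (X : 'M[C]_(m, n)) :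
  \rank (X^t*) = \rank X.
Proof. by rewrite mxrank_map mxrank_tr. Qed.

(** * Frames and the core-EP inverse *)

(** From its index on, the range of the powers of M no longer shrinks; Y records
    that the columns of M^ind lie in the range of every higher power. *)
Lemma mxind_stable (C : numClosedFieldType) (n : nat) (M : 'M[C]_n) (j : nat) :
  exists Y, M ^+ mxind M = M ^+ j *m M ^+ mxind M *m Y.
Proof.
have /eqP rkE : \rank (M ^+ (mxind M).+1) == \rank (M ^+ mxind M).
  by rewrite /mxind; case: ex_minnP.
set V := M ^+ mxind M in rkE *.
have [Y VY] : exists Y, V = M *m V *m Y.
  have MV : M ^+ (mxind M).+1 = V *m M by rewrite exprSr.
  have sub : ((V *m M)^T <= V^T)%MS by rewrite trmx_mul submxMl.
  have := mxrank_leqif_sup sub; rewrite !mxrank_tr -MV rkE => -[_].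
  rewrite eqxx => /esym/submxP[D]; rewrite MV => /(congr1 trmx).
  rewrite trmxK trmx_mul trmxK => VE; exists D^T.
  by rewrite [LHS]VE; congr (_ *m _); rewrite -MV exprS.
elim: j => [|j [Z VZ]]; first by exists 1%:M; rewrite expr0 mulmx1 mul1mx.
exists (Z *m Y).
have -> : M ^+ j.+1 *m V *m (Z *m Y) = M *m (M ^+ j *m V *m Z) *m Y.
  by rewrite exprS -mulmxE !mulmxA.
by rewrite -VZ.
Qed.

(** F is an orthonormal basis of R(M^m), m = ind(M), and T is the matrix of M on
    that subspace.  The factorization asks only for some power of M, which is
    equivalent and spares computing the index when M changes. *)
Definition core_frame (C : numClosedFieldType) (n q : nat) (M : 'M[C]_n)
    (F : 'M[C]_(n, q)) (T : 'M[C]_q) : Prop :=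
  [/\ F^t* *m F = 1%:M, T \in unitmx, M *m F = F *m T &
      exists j G, M ^+ j = F *m G].

(** As M is bijective on the span of F, that span lies in the range of every
    power of M. *)
Lemma core_frame_expr (C : numClosedFieldType) (n q : nat) (M : 'M[C]_n)
    (F : 'M[C]_(n, q)) (T : 'M[C]_q) (j : nat) :
  core_frame M F T -> exists Y, F = M ^+ j *m F *m Y.
Proof.
case=> _ Tu MF _; elim: j => [|j [Y FY]].
  by exists 1%:M; rewrite expr0 mulmx1 mul1mx.
exists (Y *m invmx T).
rewrite exprS -mulmxE.
have -> : M *m M ^+ j *m F *m (Y *m invmx T)
  = M *m (M ^+ j *m F *m Y) *m invmx T by rewrite !mulmxA.
by rewrite -FY MF mulmxK.
Qed.

(** The two inclusions of R(M^ind) = span F combined: the one from left to right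
    gives G, and the other one a right inverse of G. *)
Lemma core_frame_mxind (C : numClosedFieldType) (n q : nat) (M : 'M[C]_n)
    (F : 'M[C]_(n, q)) (T : 'M[C]_q) :
  core_frame M F T -> exists G, M ^+ mxind M = F *m G /\ row_free G.
Proof.
move=> fr; have [FF Tu MF [j [G MG]]] := fr.
have [Y MY] := mxind_stable M j.
have [Z FZ] := core_frame_expr (mxind M) fr.
pose H := G *m M ^+ mxind M *m Y.
have MH : M ^+ mxind M = F *m H by rewrite [LHS]MY MG !mulmxA.
exists H; split=> //; apply/row_freeP; exists (F *m Z).
have FH : F *m (H *m (F *m Z)) = F by rewrite [RHS]FZ MH !mulmxA.
by move: (congr1 (mulmx (F^t*)) FH); rewrite mulmxA FF mul1mx.
Qed.

(** The formula is checked against the three defining equations.  For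
    uniqueness, a solution X satisfies X = M^j X^(j+1) for all j, so its columns
    lie in the span of F; it also inverts M there, so the hermitian matrix M X
    fixes F and has its range in the span of F, which makes it the projector
    F F^*. *)
Lemma core_EP_frame (C : numClosedFieldType) (n q : nat) (M : 'M[C]_n)
    (F : 'M[C]_(n, q)) (T : 'M[C]_q) :
  core_frame M F T -> core_EP M = F *m invmx T *m F^t*.
Proof.
move=> fr; have [FF Tu MF _] := fr.
have [G [MG _]] := core_frame_mxind fr.
have [Z FZ] := core_frame_expr (mxind M) fr.
have MFT : M *m (F *m invmx T *m F^t*) = F *m F^t*.
  by rewrite !mulmxA MF mulmxK.
rewrite /core_EP; apply: xget_unique => /=.
  split.
  - rewrite exprS -mulmxE MG (mulmxA M) MF !mulmxA.
    rewrite -(mulmxA _ (F^t*) F) FF mulmx1.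
    by rewrite -(mulmxA F) mulVmx // mulmx1.
  - rewrite expr2 -mulmxE mulmxA MFT !mulmxA -(mulmxA F (F^t*) F) FF mulmx1 //.
  - by rewrite MFT adjmxM adjmxK.
move=> X [XM MX2 MXh].
set V := M ^+ mxind M in MG FZ XM.
(* on the span of F, the equation X M^(m+1) = M^m makes X the inverse of M *)
have XF : X *m F = F *m invmx T.
  apply: (can_inj (mulmxK Tu)); rewrite mulmxKV // -mulmxA -MF.
  rewrite FZ !mulmxA -(mulmxA X M V).
  have -> : M *m V = M ^+ (mxind M).+1 by rewrite exprS.
  by rewrite XM.
have MXF : M *m X *m F = F by rewrite -mulmxA XF mulmxA MF mulmxK.
have Xj j : X = M ^+ j *m X ^+ j.+1.
  elim: j => [|j IH]; first by rewrite expr0 expr1 mul1mx.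
  have XS : X ^+ j.+1 = M *m X ^+ j.+2.
    by rewrite -[j.+2]addn2 addnC exprD exprS -!mulmxE mulmxA MX2.
  by rewrite [LHS]IH XS (exprSr M) -mulmxE mulmxA.
have FFX : F *m F^t* *m X = X.
  rewrite [in RHS](Xj (mxind M)) [in LHS](Xj (mxind M)) -/V MG !mulmxA.
  by rewrite -(mulmxA F (F^t*) F) FF mulmx1.
have MXE : M *m X = F *m T *m F^t* *m X.
  by rewrite -[in LHS]FFX !mulmxA MF.
have MXP : M *m X = F *m F^t*.
  have eqL : F *m F^t* *m (M *m X) = M *m X.
    by rewrite MXE !mulmxA -(mulmxA F (F^t*) F) FF mulmx1.
  by rewrite -MXh -eqL !adjmxM adjmxK -adjmxM MXh mulmxA MXF.
have FX : F^t* *m X = invmx T *m F^t*.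
  apply: (can_inj (mulKmx Tu)); rewrite mulKVmx //.
  by rewrite -[RHS]mul1mx -FF -(mulmxA (F^t*)) -MXP MXE !mulmxA FF mul1mx.
by rewrite -FFX -mulmxA FX mulmxA.
Qed.

Lemma core_frame_compression (C : numClosedFieldType) (n q : nat) (M : 'M[C]_n)
    (F : 'M[C]_(n, q)) (T : 'M[C]_q) :
  core_frame M F T -> M ^+ 2 *m core_EP M = F *m T *m F^t*.
Proof.
move=> fr; have [_ Tu MF _] := fr; rewrite (core_EP_frame fr) !mulmxA.
by rewrite expr2 -mulmxE -(mulmxA M) MF mulmxA mulmxK // MF.
Qed.

(** L_B has the same frame as B, hence the same core-EP inverse. *)
Lemma core_frame_core_part (C : numClosedFieldType) (n q : nat) (M : 'M[C]_n)
    (F : 'M[C]_(n, q)) (T : 'M[C]_q) :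
  core_frame M F T -> core_frame (M ^+ 2 *m core_EP M) F T.
Proof.
move=> fr; have [FF Tu _ _] := fr.
rewrite (core_frame_compression fr); split=> //.
  by rewrite -mulmxA FF mulmx1.
by exists 1%N, (T *m F^t*); rewrite expr1 mulmxA.
Qed.

Lemma core_EP_proj_frame (C : numClosedFieldType) (n q : nat) (M : 'M[C]_n)
    (F : 'M[C]_(n, q)) (T : 'M[C]_q) :
  core_frame M F T -> core_EP_proj M = 1%:M - F *m F^t*.
Proof.
move=> fr; have [_ Tu MF _] := fr.
by rewrite /core_EP_proj (core_EP_frame fr) !mulmxA MF mulmxK.
Qed.

Lemma core_frame_rank (C : numClosedFieldType) (n q : nat) (M : 'M[C]_n)
    (F : 'M[C]_(n, q)) (T : 'M[C]_q) :
  core_frame M F T -> \rank (M ^+ mxind M) = q.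
Proof.
move=> fr; have [FF _ _ _] := fr; have [G [-> /eqP rkG]] := core_frame_mxind fr.
apply/eqP; rewrite eqn_leq (leq_trans (mxrankM_maxl _ _) (rank_leq_col _)) /=.
by rewrite -{1}rkG -[G in \rank G]mul1mx -FF -mulmxA mxrankM_maxr.
Qed.

Lemma mxrank_compression (C : numClosedFieldType) (n q : nat)
    (F : 'M[C]_(n, q)) (M : 'M[C]_q) :
  F^t* *m F = 1%:M -> M \in unitmx -> \rank (F *m M *m F^t*) = q.
Proof.
move=> FF Mu; apply/eqP; rewrite eqn_leq -mulmxA.
rewrite (leq_trans (mxrankM_maxl _ _) (rank_leq_col _)) /=.
rewrite -[X in (X <= _)%N](mxrank1 C) -(mulmxV Mu).
have -> : M *m invmx M = F^t* *m (F *m (M *m F^t*)) *m (F *m invmx M).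
  by rewrite !mulmxA FF mul1mx -(mulmxA M) FF mulmx1.
exact: leq_trans (mxrankM_maxl _ _) (mxrankM_maxr _ _).
Qed.

(** * The core-EP decomposition *)

(** The two halves E, E' of the columns of U replace the cast block matrices by
    sums of products in which no dimension is split. *)
Lemma sqblock_conjE (C : numClosedFieldType) (n r : nat) (hr : (r <= n)%N)
    (U : 'M[C]_n) (a : 'M[C]_r) (b : 'M[C]_(r, n - r))
    (c : 'M[C]_(n - r, r)) (d : 'M[C]_(n - r)) :
  let U' := castmx (erefl n, esym (subnKC hr)) U in
  let E := lsubmx U' in let E' := rsubmx U' in
  U *m sqblock hr a b c d *m U^t* =
  E *m a *m E^t* + E *m b *m E'^t* + E' *m c *m E^t* + E' *m d *m E'^t*.
Proof.
rewrite /sqblock /=; move: (n - r)%N (subnKC hr) b c d => p e b c d.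
case: n / e U {hr} => U; rewrite !castmx_id.
rewrite -{1 2}[U]hsubmxK mul_row_block tr_row_mx map_col_mx mul_row_col.
rewrite !mulmxDl !addrA; congr (_ + _).
by rewrite -!addrA; congr (_ + _); rewrite addrC.
Qed.

Lemma unitary_halves (C : numClosedFieldType) (n r : nat) (hr : (r <= n)%N)
    (U : 'M[C]_n) :
  let U' := castmx (erefl n, esym (subnKC hr)) U in
  let E := lsubmx U' in let E' := rsubmx U' in
  U \is unitarymx -> [/\ E^t* *m E = 1%:M, E'^t* *m E' = 1%:M,
   E^t* *m E' = 0, E'^t* *m E = 0 & E *m E^t* + E' *m E'^t* = 1%:M].
Proof.
move=> /=; move: (n - r)%N (subnKC hr) => p e.
case: n / e U {hr} => U; rewrite !castmx_id => /unitarymxP UU.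
have := mulmx1C UU; rewrite -{1 2}[U]hsubmxK tr_row_mx map_col_mx mul_col_row.
rewrite (scalar_mx_block r p 1) => /eq_block_mx[-> -> -> ->]; split=> //.
rewrite -scalar_mx_block -UU -[in RHS](hsubmxK U).
by rewrite tr_row_mx map_col_mx mul_row_col.
Qed.

Lemma orthonormal_range (C : numClosedFieldType) (n : nat) (V : 'M[C]_n) :
  exists E : 'M[C]_(n, \rank V), E^t* *m E = 1%:M /\ exists G, V = E *m G.
Proof.
have [W [WW sub]] : exists W : 'M[C]_(\rank V, n),
    W \is unitarymx /\ (V^t* <= W)%MS.
  rewrite -(mxrank_adj V); exists (schmidt (row_base (V^t*))).
  rewrite schmidt_unitarymx ?rank_leq_col //; split=> //.
  by apply: submx_trans (schmidt_sub _); rewrite eq_row_base.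
exists (W^t*); rewrite adjmxK; split; first exact/unitarymxP.
have /submxP[D VD] := sub; exists (D^t*).
by rewrite -adjmxM -VD adjmxK.
Qed.

Lemma orthonormal_completion (C : numClosedFieldType) (n r : nat)
    (E : 'M[C]_(n, r)) : E^t* *m E = 1%:M ->
  exists (hr : (r <= n)%N) (U : 'M[C]_n), U \is unitarymx /\
    lsubmx (castmx (erefl n, esym (subnKC hr)) U) = E.
Proof.
move=> EE.
have Wu : E^t* \is unitarymx by apply/unitarymxP; rewrite adjmxK.
have rW : \rank (E^t*) = r := mxrank_unitary Wu.
have hr : (r <= n)%N by rewrite -rW rank_leq_col.
exists hr.
have [W [WW WE]] : exists W : 'M[C]_(n - r, n), W \is unitarymx /\ W *m E = 0.
  have <- : \rank (kermx E) = (n - r)%N by rewrite mxrank_ker -mxrank_adj rW.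
  exists (schmidt (row_base (kermx E))).
  rewrite schmidt_unitarymx ?rank_leq_col //; split=> //; apply/sub_kermxP.
  by rewrite eqmx_schmidt_free ?row_base_free // eq_row_base.
have EW : E^t* *m W^t* = 0 by rewrite -adjmxM WE trmx0 map_mx0.
exists (castmx (erefl n, subnKC hr) (row_mx E (W^t*))); split; last first.
  by rewrite castmx_comp castmx_id row_mxKl.
move/unitarymxP: WW => WW.
move: (n - r)%N (subnKC hr) W WW WE EW => p e W WW WE EW {hr}.
case: n / e E EE W Wu rW WW WE EW => E EE W _ _ WW WE EW.
rewrite castmx_id; apply/unitarymxP/mulmx1C.
rewrite tr_row_mx map_col_mx adjmxK mul_col_row EE WW WE EW.
by rewrite -scalar_mx_block.
Qed.

(** The first r columns of U form a frame: E'^* A^j = N^j E'^* for the remaining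
    columns E', so nilpotency puts R(A^k) into the span of E. *)
Lemma core_EP_decomposition_frame (C : numClosedFieldType) (n : nat)
    (A : 'M[C]_n) (r : nat) (hr : (r <= n)%N) (U : 'M[C]_n)
    (T : 'M[C]_r) (S : 'M[C]_(r, n - r)) (N : 'M[C]_(n - r)) :
  core_EP_decomposition A hr U T S N ->
  core_frame A (lsubmx (castmx (erefl n, esym (subnKC hr)) U)) T.
Proof.
move=> [Uu Tu Nk _]; rewrite sqblock_conjE.
have [] := unitary_halves hr Uu; set E := lsubmx _; set E' := rsubmx _.
move=> EE E'E' EE' E'E split1 AE.
split=> //.
  rewrite AE !mulmxDl -!(mulmxA _ (E^t*) E) EE -!(mulmxA _ (E'^t*) E) E'E.
  by rewrite !(mulmx0, mulmx1, addr0).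
have E'A : E'^t* *m A = N *m E'^t*.
  rewrite AE !mulmxDr !mulmxA E'E E'E' !mul1mx.
  by rewrite !(mul0mx, add0r).
have E'Aj j : E'^t* *m A ^+ j = N ^+ j *m E'^t*.
  elim: j => [|j IH]; first by rewrite !expr0 mulmx1 mul1mx.
  by rewrite !exprS -!mulmxE mulmxA E'A -mulmxA IH mulmxA.
exists (mxind A), (E^t* *m A ^+ mxind A).
rewrite -[LHS]mul1mx -split1 mulmxDl -!mulmxA E'Aj Nk.
by rewrite mul0mx mulmx0 addr0.
Qed.

(** U is any unitary matrix whose first columns span V = R(A^k).  Invariance of
    V gives the zero block, A V = V makes T nonsingular, and A^k maps everything
    into V, so the compression N of A to the orthogonal complement of V
    satisfies N^k = 0. *)
Lemma core_EP_decomposition_exists (C : numClosedFieldType) (n : nat)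
    (A : 'M[C]_n) :
  exists r (hr : (r <= n)%N) U T S N,
    @core_EP_decomposition C n A r hr U T S N.
Proof.
have [E [EE [G AG]]] := orthonormal_range (A ^+ mxind A).
set r := \rank _ in E EE G AG.
have [hr [U [Uu UE]]] := orthonormal_completion EE.
have := unitary_halves hr Uu; rewrite /= UE; set E' := rsubmx _.
move=> [_ E'E' EE' E'E split1].
have /row_freeP[H GH] : row_free G.
  have rkG : (\rank (A ^+ mxind A) <= \rank G)%N.
    by rewrite {1}AG mxrankM_maxr.
  by rewrite -row_leq_rank.
have EH : E = A ^+ mxind A *m H by rewrite AG -mulmxA GH mulmx1.
have AV : A *m A ^+ mxind A = A ^+ mxind A *m A.
  by rewrite mulmxE -exprS exprSr.
have AE : A *m E = E *m (G *m A *m H).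
  by rewrite {1}EH mulmxA AV AG !mulmxA.
have E'AE : E'^t* *m A *m E = 0 by rewrite -mulmxA AE mulmxA E'E mul0mx.
have E'A : E'^t* *m A = E'^t* *m A *m E' *m E'^t*.
  by rewrite -[LHS]mulmx1 -split1 mulmxDr !mulmxA E'AE mul0mx add0r.
exists r, hr, U, (E^t* *m A *m E), (E^t* *m A *m E'), (E'^t* *m A *m E').
split=> //.
- have [Y VY] := mxind_stable A 1.
  suff : E^t* *m A *m E *m (G *m Y *m H) = 1%:M by case/mulmx1_unit.
  have EY : A *m E *m (G *m Y *m H) = E.
    by rewrite [RHS]EH [in RHS]VY expr1 AG !mulmxA.
  have <- : E^t* *m (A *m E *m (G *m Y *m H)) = 1%:M by rewrite EY.
  by rewrite !mulmxA.
- have E'Aj j : E'^t* *m A ^+ j = (E'^t* *m A *m E') ^+ j *m E'^t*.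
    elim: j => [|j IH]; first by rewrite !expr0 mulmx1 mul1mx.
    by rewrite !exprS -!mulmxE [LHS]mulmxA [in LHS]E'A -[LHS]mulmxA IH mulmxA.
  rewrite -[LHS]mulmx1 -E'E' mulmxA -E'Aj AG !mulmxA E'E !mul0mx //.
rewrite sqblock_conjE UE -/E' mulmx0 mul0mx addr0.
have EA : E^t* *m A = E^t* *m A *m E *m E^t* + E^t* *m A *m E' *m E'^t*.
  by rewrite -[LHS]mulmx1 -split1 mulmxDr !mulmxA.
rewrite -[LHS]mul1mx -split1 mulmxDl -(mulmxA E) [in LHS]EA.
rewrite -(mulmxA E' _ A) [in LHS]E'A.
by rewrite mulmxDr !mulmxA.
Qed.

(** * The overlap of two frames *)

Lemma row_free_full_inv (C : numClosedFieldType) (m n : nat)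
    (K : 'M[C]_(m, n)) :
  row_free K -> row_full K -> exists K', K *m K' = 1%:M /\ K' *m K = 1%:M.
Proof.
move=> /row_freeP[K1 KK1] /row_fullP[K2 K2K]; exists K1; split=> //.
by rewrite -K2K -[K1]mul1mx -K2K -(mulmxA K2) KK1 mulmx1.
Qed.

(** The numbers r and q are not known to agree in advance; asking for full row
    and full column rank says that the overlap is square and nonsingular without
    transporting E or F along an equality of dimensions. *)
Definition nonsingular_overlap (C : numClosedFieldType) (n r q : nat)
    (E : 'M[C]_(n, r)) (F : 'M[C]_(n, q)) : Prop :=
  row_free (E^t* *m F) /\ row_full (E^t* *m F).

(** With K the overlap matrix, the compression of F M F^* to the span of E is
    K M K^*, whose rank is at most that of K. *)
Lemma overlapP (C : numClosedFieldType) (n r q : nat) (E : 'M[C]_(n, r))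
    (F : 'M[C]_(n, q)) (M : 'M[C]_q) : M \in unitmx ->
  nonsingular_overlap E F <-> q = r /\ E^t* *m (F *m M *m F^t*) *m E \in unitmx.
Proof.
move=> Mu; have adjK : F^t* *m E = (E^t* *m F)^t* by rewrite adjmxM adjmxK.
rewrite -!mulmxA adjK !mulmxA /nonsingular_overlap; set K := E^t* *m F; split.
  move=> [Kfree Kfull]; split; first by rewrite -(eqP Kfree) -[LHS](eqP Kfull).
  have [K' [KK' K'K]] := row_free_full_inv Kfree Kfull.
  suff : K *m M *m K^t* *m (K'^t* *m invmx M *m K') = 1%:M.
    by case/mulmx1_unit.
  rewrite !mulmxA -(mulmxA _ (K^t*)) -adjmxM K'K adjmx1 mulmx1.
  by rewrite mulmxK.
move=> [qr]; rewrite -row_free_unit => /eqP rk.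
have rK : \rank K = r.
  apply/eqP; rewrite eqn_leq rank_leq_row /= -{1}rk -mulmxA.
  exact: mxrankM_maxl.
by split; apply/eqP; rewrite rK.
Qed.

Lemma overlapC (C : numClosedFieldType) (n r q : nat) (E : 'M[C]_(n, r))
    (F : 'M[C]_(n, q)) : nonsingular_overlap E F <-> nonsingular_overlap F E.
Proof.
have adjK : F^t* *m E = (E^t* *m F)^t* by rewrite adjmxM adjmxK.
rewrite /nonsingular_overlap adjK /row_free /row_full mxrank_adj.
by split=> -[].
Qed.

(** * The conditions in terms of frames *)

(** Let D = 1 - (E E^* - F F^* )^2 and K = E^* F.  Expanding the square gives
    D E = E K K^* and D F = F K^* K.  If D is nonsingular, cancelling it
    produces one-sided inverses of K.  If K is nonsingular and x D = 0, these
    identities give x E = 0 and x F = 0, and then x D = x. *)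
Lemma stable_perturbation_frame (C : numClosedFieldType) (n r q : nat)
    (A B : 'M[C]_n) (E : 'M[C]_(n, r)) (T : 'M[C]_r) (F : 'M[C]_(n, q))
    (M : 'M[C]_q) : core_frame A E T -> core_frame B F M ->
  stable_perturbation A B <-> nonsingular_overlap E F.
Proof.
move=> frA frB; have [EE _ _ _] := frA; have [FF _ _ _] := frB.
rewrite /stable_perturbation /nonsingular_overlap (core_EP_proj_frame frA).
rewrite (core_EP_proj_frame frB).
have [K KE] : exists K, E^t* *m F = K by exists (E^t* *m F).
have KC : F^t* *m E = K^t* by rewrite -KE adjmxM adjmxK.
rewrite KE.
have -> : 1%:M - F *m F^t* - (1%:M - E *m E^t*) = E *m E^t* - F *m F^t*.
  by rewrite opprB addrC addrA subrK.
have -> : (E *m E^t* - F *m F^t*) ^+ 2 =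
    E *m E^t* + F *m F^t* - E *m K *m F^t* - F *m K^t* *m E^t*.
  rewrite expr2 -mulmxE mulmxBl !mulmxBr !mulmxA.
  rewrite -(mulmxA E (E^t*) E) EE -(mulmxA F (F^t*) F) FF !mulmx1.
  rewrite -(mulmxA E (E^t*) F) KE -(mulmxA F (F^t*) E) KC.
  by rewrite opprB addrA (addrAC _ (- _)).
set D := 1%:M - _.
have DF : D *m F = F *m (K^t* *m K).
  rewrite /D mulmxBl mul1mx !mulmxBl mulmxDl.
  rewrite -(mulmxA E (E^t*) F) KE -(mulmxA F (F^t*) F) FF.
  rewrite -(mulmxA _ (F^t*) F) FF !mulmx1 -(mulmxA _ (E^t*) F) KE.
  by rewrite [_ + F]addrC addrK opprB addrC subrK mulmxA.
have DE : D *m E = E *m (K *m K^t*).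
  rewrite /D mulmxBl mul1mx !mulmxBl mulmxDl.
  rewrite -(mulmxA E (E^t*) E) EE -(mulmxA F (F^t*) E) KC.
  rewrite -(mulmxA _ (E^t*) E) EE -(mulmxA _ (F^t*) E) KC !mulmx1.
  by rewrite addrAC addrK opprB addrC subrK mulmxA.
split.
  move=> Du; split.
    have YK : E^t* *m invmx D *m E *m K *m K^t* = 1%:M.
      by rewrite -!mulmxA -DE mulKmx.
    apply/row_freeP; exists ((E^t* *m invmx D *m E *m K)^t*).
    have := adjmxM (E^t* *m invmx D *m E *m K) (K^t*).
    by rewrite YK adjmx1 adjmxK.
  apply/row_fullP; exists (F^t* *m invmx D *m F *m K^t*).
  by rewrite -!mulmxA -DF mulKmx.
move=> [Kfree Kfull].
have [K' [KK' K'K]] := row_free_full_inv Kfree Kfull.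
rewrite -row_free_unit; apply: inj_row_free => x xD.
have xF : x *m F = 0.
  have : x *m D *m F = 0 by rewrite xD mul0mx.
  rewrite -mulmxA DF !mulmxA => /(congr1 (mulmx^~ (K' *m K'^t*))).
  rewrite mul0mx !mulmxA -(mulmxA _ K) KK' mulmx1.
  by rewrite -(mulmxA _ (K^t*)) -adjmxM K'K adjmx1 mulmx1.
have xE : x *m E = 0.
  have : x *m D *m E = 0 by rewrite xD mul0mx.
  rewrite -mulmxA DE !mulmxA => /(congr1 (mulmx^~ (K'^t* *m K'))).
  rewrite mul0mx !mulmxA -(mulmxA _ (K^t*)) -adjmxM K'K adjmx1 mulmx1.
  by rewrite -(mulmxA _ K) KK' mulmx1.
move: xD; rewrite /D mulmxBr mulmx1 !mulmxBr mulmxDr !mulmxA xE xF.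
by rewrite !mul0mx !(addr0, subr0).
Qed.

(** A vector of R(A^k) is E y, and it is annihilated by (B^s)^* if and only if
    F^* E y = 0. *)
Lemma cap_trivial_frame (C : numClosedFieldType) (n r q : nat)
    (A B : 'M[C]_n) (E : 'M[C]_(n, r)) (T : 'M[C]_r) (F : 'M[C]_(n, q))
    (M : 'M[C]_q) : core_frame A E T -> core_frame B F M ->
  mxrange (A ^+ mxind A) `&` mxnull ((B ^+ mxind B)^t*) = [set 0] <->
  row_full (F^t* *m E).
Proof.
move=> frA frB.
have [G [AG _]] := core_frame_mxind frA.
have [Z EZ] := core_frame_expr (mxind A) frA.
have [H [BH /row_freeP[H' HH']]] := core_frame_mxind frB.
have EE : E^t* *m E = 1%:M by case: frA.
have nullB (x : 'cV_n) : (B ^+ mxind B)^t* *m x = 0 <-> F^t* *m x = 0.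
  rewrite BH adjmxM -mulmxA; split=> [|->]; last by rewrite mulmx0.
  move=> /(congr1 (mulmx (H'^t*))).
  by rewrite mulmxA -adjmxM HH' adjmx1 mul1mx mulmx0.
split=> [cap0|Kfull].
  rewrite /row_full -mxrank_tr -/(row_free _); apply: inj_row_free => y yK.
  have Ky : F^t* *m E *m y^T = 0 by rewrite -[LHS]trmxK trmx_mul trmxK yK trmx0.
  have : (mxrange (A ^+ mxind A) `&` mxnull ((B ^+ mxind B)^t*)) (E *m y^T).
    split; last by apply/nullB; rewrite mulmxA.
    by exists (E *m Z *m y^T) => //; rewrite !mulmxA -EZ.
  rewrite cap0 => /(congr1 (mulmx (E^t*))).
  by rewrite mulmxA EE mul1mx mulmx0 => y0; rewrite -[y]trmxK y0 trmx0.
apply/seteqP; split=> x /=; last first.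
  move=> ->; split; last by apply/nullB; rewrite mulmx0.
  by exists 0 => //; rewrite mulmx0.
move=> [[z _ <-] /nullB].
have [L LK] := row_fullP Kfull.
rewrite AG -(mulmxA E) (mulmxA _ E) => /(congr1 (mulmx L)).
by rewrite (mulmxA L) LK mul1mx mulmx0 => ->; rewrite mulmx0.
Qed.

(** A^k = E G with G right invertible, and such a G does not change ranks. *)
Lemma gram_rank_frame (C : numClosedFieldType) (n r : nat)
    (A : 'M[C]_n) (E : 'M[C]_(n, r)) (T : 'M[C]_r) (X : 'M[C]_n) :
  core_frame A E T ->
  \rank ((A ^+ mxind A)^t* *m X *m A ^+ mxind A) = \rank (E^t* *m X *m E).
Proof.
move=> frA; have [G [-> /row_freeP[H GH]]] := core_frame_mxind frA.
have [V VE] : exists V, E^t* *m X *m E = V by exists (E^t* *m X *m E).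
have -> : (E *m G)^t* *m X *m (E *m G) = G^t* *m V *m G.
  by rewrite adjmxM -VE !mulmxA.
rewrite VE; apply/eqP; rewrite eqn_leq.
rewrite (leq_trans (mxrankM_maxl _ _) (mxrankM_maxr _ _)) /=.
have {1}-> : V = H^t* *m (G^t* *m V *m G) *m H.
  by rewrite !mulmxA -adjmxM GH adjmx1 mul1mx -mulmxA GH mulmx1.
exact: leq_trans (mxrankM_maxl _ _) (mxrankM_maxr _ _).
Qed.

(** Put G = 1 + (X - A) E T^-1 E^*.  It differs from 1 only through E^*, and
    E^* G = (E^* X E) T^-1 E^*: in a basis adapted to E, G is block triangular
    with diagonal blocks (E^* X E) T^-1 and 1. *)
Lemma unitmx_1D_frame (C : numClosedFieldType) (n r : nat)
    (A : 'M[C]_n) (E : 'M[C]_(n, r)) (T : 'M[C]_r) (X : 'M[C]_n) :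
  core_frame A E T ->
  (1%:M + (X - A) *m core_EP A \in unitmx) = (E^t* *m X *m E \in unitmx).
Proof.
move=> frA; have [EE Tu AE _] := frA.
rewrite (core_EP_frame frA).
have [W WE] : exists W, E^t* *m X *m E = W by exists (E^t* *m X *m E).
rewrite WE; set G := 1%:M + _.
have EG : E^t* *m G = W *m invmx T *m E^t*.
  rewrite /G mulmxDr mulmx1 mulmxBl mulmxBr !mulmxA WE.
  rewrite -(mulmxA _ A) AE !mulmxA EE mul1mx mulmxV // mul1mx.
  by rewrite addrC subrK.
apply/idP/idP => [Gu|Wu].
  suff : W *m (invmx T *m E^t* *m invmx G *m E) = 1%:M by case/mulmx1_unit.
  by rewrite !mulmxA -EG mulmxK.
rewrite -unitmx_tr -row_free_unit; apply: inj_row_free => y yG.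
have Gy : G *m y^T = 0 by rewrite -[LHS]trmxK trmx_mul trmxK yG trmx0.
have Ey : E^t* *m y^T = 0.
  have := congr1 (mulmx (E^t*)) Gy; rewrite mulmxA EG mulmx0.
  move=> /(congr1 (mulmx (T *m invmx W))).
  by rewrite mulmx0 !mulmxA -(mulmxA _ _ W) mulVmx // mulmx1 mulmxV // mul1mx.
move: Gy; rewrite /G mulmxDl mul1mx -!mulmxA Ey !mulmx0 addr0 => y0.
by rewrite -[y]trmxK y0 trmx0.
Qed.

(** The equation says that G^-1 L_B has its range in the span of E, so the rank
    q of L_B is at most r; the nonsingular compression E^* L_B E gives r <= q.
    Conversely, when the overlap is nonsingular, the columns of
    G E = L_B E T^-1 span the same space as those of F, so G^-1 maps span F to
    span E. *)
Lemma schur_complement_frame (C : numClosedFieldType) (n r q : nat)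
    (A B : 'M[C]_n) (E : 'M[C]_(n, r)) (T : 'M[C]_r) (F : 'M[C]_(n, q))
    (M : 'M[C]_q) : core_frame A E T -> core_frame B F M ->
  let LB := B ^+ 2 *m core_EP B in
  let G := 1%:M + (LB - A) *m core_EP A in
  (G \in unitmx /\ core_EP_proj A *m invmx G *m LB = 0) <->
  nonsingular_overlap E F.
Proof.
move=> frA frB LB G; have [EE Tu AE _] := frA; have [FF Mu _ _] := frB.
have LBE : LB = F *m M *m F^t* := core_frame_compression frB.
have Gu : (G \in unitmx) = (E^t* *m LB *m E \in unitmx).
  exact: unitmx_1D_frame frA.
have rkLB : \rank LB = q by rewrite LBE mxrank_compression.
rewrite (core_EP_proj_frame frA); split.
  move=> [Gun]; move: (Gun); rewrite Gu => Wu.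
  rewrite mulmxBl mul1mx mulmxBl => /eqP; rewrite subr_eq0 => /eqP iGL.
  apply/(overlapP _ _ Mu); rewrite -LBE; split=> //.
  apply/eqP; rewrite eqn_leq -[in X in X && _]rkLB; apply/andP; split.
    rewrite -[LB](mulKVmx Gun) iGL -!(mulmxA E) (mulmxA G).
    exact: leq_trans (mxrankM_maxl _ _) (rank_leq_col _).
  move: Wu; rewrite -row_free_unit => /eqP rW.
  rewrite -[X in (X <= _)%N]rW -rkLB.
  exact: leq_trans (mxrankM_maxl _ _) (mxrankM_maxr _ _).
move=> ov; have [qr Wu] := (overlapP _ _ Mu).1 ov.
have Gun : G \in unitmx by rewrite Gu LBE.
split=> //.
have [Kfree Kfull] := (overlapC _ _).1 ov.
have [K' [KK' _]] := row_free_full_inv Kfree Kfull.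
have GE : G *m E = F *m (M *m (F^t* *m E) *m invmx T).
  rewrite /G (core_EP_frame frA) LBE mulmxDl mul1mx -!mulmxA EE mulmx1.
  by rewrite mulmxBl !mulmxA AE mulmxK // addrC subrK.
have FE : F = G *m E *m (T *m K' *m invmx M).
  rewrite GE -!mulmxA !(mulmxA (invmx T)) mulVmx // mul1mx.
  by rewrite (mulmxA (F^t*)) (mulmxA (F^t* *m E)) KK' mul1mx mulmxV // mulmx1.
rewrite LBE {1}FE -(mulmxA G) !mulmxA -(mulmxA _ (invmx G) G) mulVmx // mulmx1.
by rewrite mulmxBl mul1mx -(mulmxA E) EE mulmx1 subrr !mul0mx.
Qed.

(** Write U = (E E').  The block form is the factorization
    L_B = (E + E' Q) B1 (E^* + P E'^* ), which yields E^* L_B E = B1 and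
    rk L_B = r.  For the converse, put K = E^* F: when K is nonsingular, the
    span of F is the graph of some Q over the span of E, that is
    F = (E + E' Q) K, so L_B = F M F^* factors with B1 = K M K^* and P = Q^*. *)
Lemma block_frame (C : numClosedFieldType) (n r q : nat) (hr : (r <= n)%N)
    (U : 'M[C]_n) (B : 'M[C]_n) (F : 'M[C]_(n, q)) (M : 'M[C]_q) :
  U \is unitarymx -> core_frame B F M ->
  let LB := B ^+ 2 *m core_EP B in
  (exists B1 P Q,
     [/\ B1 \in unitmx, 1%:M + P *m Q \in unitmx &
         LB = U *m sqblock hr B1 (B1 *m P) (Q *m B1) (Q *m B1 *m P) *m U^t*])
  <-> nonsingular_overlap (lsubmx (castmx (erefl n, esym (subnKC hr)) U)) F.
Proof.
move=> Uu frB LB; have [FF Mu _ _] := frB.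
have LBE : LB = F *m M *m F^t* := core_frame_compression frB.
have rkLB : \rank LB = q by rewrite LBE mxrank_compression.
have [] := unitary_halves hr Uu; set E := lsubmx _; set E' := rsubmx _.
move=> EE E'E' EE' E'E split1.
have factor B1 P Q :
    U *m sqblock hr B1 (B1 *m P) (Q *m B1) (Q *m B1 *m P) *m U^t* =
    (E + E' *m Q) *m B1 *m (E^t* + P *m E'^t*).
  by rewrite sqblock_conjE -/E -/E' !mulmxDl !mulmxDr !mulmxA !addrA.
split.
  move=> [B1 [P [Q [B1u _]]]]; rewrite factor => LBf.
  have W : E^t* *m LB *m E = B1.
    rewrite LBf !mulmxA (mulmxDr _ E) EE (mulmxA _ E') EE' mul0mx addr0 mul1mx.
    by rewrite -mulmxA mulmxDl EE -mulmxA E'E mulmx0 addr0 mulmx1.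
  apply/(overlapP _ _ Mu); rewrite -LBE W; split=> //.
  apply/eqP; rewrite eqn_leq -[X in X && _](congr1 (leq^~ r) rkLB).
  rewrite [X in (\rank X <= _)%N]LBf -!mulmxA.
  rewrite (leq_trans (mxrankM_maxl _ _) (rank_leq_col _)) /=.
  have rB1 : \rank B1 = r by apply/eqP; rewrite -/(row_free _) row_free_unit.
  rewrite -[X in (X <= _)%N]rB1 -rkLB -W.
  exact: leq_trans (mxrankM_maxl _ _) (mxrankM_maxr _ _).
move=> [].
have [K KE] : exists K, E^t* *m F = K by exists (E^t* *m F).
rewrite KE => Kfree Kfull.
have [K' [KK' K'K]] := row_free_full_inv Kfree Kfull.
have [_ Wu] : q = r /\ K *m M *m K^t* \in unitmx.
  have /(overlapP _ _ Mu) : nonsingular_overlap E F.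
    by rewrite /nonsingular_overlap KE.
  by rewrite -KE adjmxM adjmxK !mulmxA.
have [Q FQ] : exists Q, F = (E + E' *m Q) *m K.
  exists (E'^t* *m F *m K').
  by rewrite mulmxDl -!mulmxA K'K mulmx1 -KE !mulmxA -mulmxDl split1 mul1mx.
have FQa : F^t* = K^t* *m (E^t* + Q^t* *m E'^t*).
  by rewrite {1}FQ adjmxM raddfD /= map_mxD -adjmxM.
exists (K *m M *m K^t*), (Q^t*), Q; split=> //; last first.
  by rewrite factor LBE {1}FQ FQa !mulmxA.
(* the columns of E + E' Q have Gram matrix 1 + Q^* Q, and it is congruent to
   F^* F = 1 through K *)
have gram : K^t* *m (1%:M + Q^t* *m Q) *m K = 1%:M.
  rewrite -FF FQa [X in _ = _ *m X]FQ !mulmxA; congr (_ *m _).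
  rewrite -!mulmxA; congr (_ *m _).
  rewrite mulmxDl !mulmxDr EE (mulmxA _ E') EE' mul0mx addr0 -!mulmxA.
  by rewrite E'E mulmx0 add0r (mulmxA (E'^t*)) E'E' mul1mx.
have K'K1 : K'^t* *m K^t* = 1%:M by rewrite -adjmxM KK' adjmx1.
have KgK : (1%:M + Q^t* *m Q) *m (K *m K^t*) = 1%:M.
  by rewrite -[RHS]K'K1 -[K'^t* in RHS]mulmx1 -gram !mulmxA K'K1 mul1mx.
by case/mulmx1_unit: KgK.
Qed.

(** * The equivalence *)

Theorem lemma3p2 (R : realType) (n : nat) (A B : 'M[R[i]]_n) (k s : nat)
    (hA : mxind A = k) (hk : (0 < k)%N) (hB : mxind B = s) :
  let LB := B ^+ 2 *m core_EP B in
  [<-> (* (i) *)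
       stable_perturbation A B;
       (* (ii) *)
       stable_perturbation A LB;
       (* (iii) *)
       \rank (B ^+ s) = \rank (A ^+ k) /\
       \rank (A ^+ k) = \rank ((A ^+ k)^t* *m LB *m A ^+ k);
       (* (iv) *)
       mxrange (A ^+ k) `&` mxnull ((B ^+ s)^t*) = [set 0] /\
       mxrange (B ^+ s) `&` mxnull ((A ^+ k)^t*) = [set 0];
       (* (v) *)
       1%:M + (LB - A) *m core_EP A \in unitmx /\
       core_EP_proj A *m invmx (1%:M + (LB - A) *m core_EP A) *m LB = 0;
       (* (vi) *)
       forall (r : nat) (hr : (r <= n)%N) (U : 'M[R[i]]_n) (T : 'M[R[i]]_r)
              (S : 'M[R[i]]_(r, n - r)) (N : 'M[R[i]]_(n - r)),
         core_EP_decomposition A hr U T S N ->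
         exists (B1 : 'M[R[i]]_r) (P : 'M[R[i]]_(r, n - r))
                (Q : 'M[R[i]]_(n - r, r)),
           [/\ B1 \in unitmx,
               1%:M + P *m Q \in unitmx &
               LB = U *m sqblock hr B1 (B1 *m P) (Q *m B1) (Q *m B1 *m P)
                      *m U^t*];
       (* (vii) *)
       \rank (B ^+ s) = \rank (A ^+ k) /\
       1%:M + (LB - A) *m core_EP A \in unitmx].
Proof.
move=> LB; rewrite -hA -hB.
have [r [hr [U [T [S [N decA]]]]]] := core_EP_decomposition_exists A.
have [q [hq [V [M [S' [N' decB]]]]]] := core_EP_decomposition_exists B.
have frA := core_EP_decomposition_frame decA.
have frB := core_EP_decomposition_frame decB.
set E := lsubmx _ in frA; set F := lsubmx _ in frB.
have [_ Mu _ _] := frB.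
have LBE : LB = F *m M *m F^t* := core_frame_compression frB.
have e1 := stable_perturbation_frame frA frB.
have e2 := stable_perturbation_frame frA (core_frame_core_part frB).
have unitE : (E^t* *m LB *m E \in unitmx) <->
    \rank (E^t* *m LB *m E) = r.
  by rewrite -row_free_unit; split=> /eqP.
have ov := overlapP E F Mu; rewrite -LBE in ov.
tfae.
- by move=> /e1/e2.
- move=> /e2/ov[qr /unitE rW].
  rewrite (core_frame_rank frA) (core_frame_rank frB).
  by rewrite (gram_rank_frame LB frA) rW.
- rewrite (core_frame_rank frA) (core_frame_rank frB).
  rewrite (gram_rank_frame LB frA) => -[qr /esym/unitE Wu].
  have [Kfree Kfull] : nonsingular_overlap E F by apply/ov.
  split; last exact/(cap_trivial_frame frB frA).
  apply/(cap_trivial_frame frA frB).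
  by have [] := (overlapC E F).1 (conj Kfree Kfull).
- move=> [/(cap_trivial_frame frA frB) c1 /(cap_trivial_frame frB frA) c2].
  apply/(schur_complement_frame frA frB); split=> //.
  have KC : (F^t* *m E)^t* = E^t* *m F by rewrite adjmxM adjmxK.
  by rewrite -KC /row_free mxrank_adj.
- move=> /(schur_complement_frame frA frB) ovEF r' hr' U' T' S1 N1 dec'.
  have [Uu _ _ _ _] := dec'.
  apply/(block_frame hr' Uu frB).
  apply/(stable_perturbation_frame (core_EP_decomposition_frame dec') frB).
  exact/e1.
- move=> /(_ _ _ _ _ _ _ decA) blk; have [Uu _ _ _ _] := decA.
  have /ov[qr Wu] := (block_frame hr Uu frB).1 blk.
  rewrite (core_frame_rank frA) (core_frame_rank frB).
  by rewrite (unitmx_1D_frame LB frA).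
- rewrite (core_frame_rank frA) (core_frame_rank frB) (unitmx_1D_frame LB frA).
  by move=> /ov/e1.
Qed.
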